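(* Let $\mathcal A$ be the MFD system matrix with time step $\tau>0$ on a mesh of size $h$, and let $\mathcal X_{\mathcal{LS}}=\mathcal Q\mathcal L^{-1}$, $\mathcal X_{\mathcal{SU}}=\mathcal U^{-1}\mathcal Q$, $\mathcal X_{\mathcal{LSU}}=\mathcal U^{-1}\mathcal Q\mathcal L^{-1}$ be the block preconditioners built from the matrices defined in the context. Assume the spectral equivalence properties $$c_{1,\boldsymbol E}\le\lambda(\mathcal Q_{\boldsymbol E}\mathcal S_{\boldsymbol E})\le c_{2,\boldsymbol E},\qquad c_{1,p}\le\lambda(\mathcal Q_p\mathcal S_p)\le c_{2,p}$$ hold. Then $$\lambda(\mathcal X_{\mathcal{LS}}\mathcal A)\in[c_1,c_2],\qquad\lambda(\mathcal X_{\mathcal{SU}}\mathcal A)\in[c_1,c_2],\qquad\lambda(\mathcal X_{\mathcal{LSU}}\mathcal A)\in[c_1,c_2],$$ where $c_1=\min(c_{1,\boldsymbol E},c_{1,p})$ and $c_2=\max(c_{2,\boldsymbol E},c_{2,p})$ are constants that do not depend on the discretization parameters $h$ and $\tau$.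
   Context: Mesh. A bounded connected domain $\Omega\subset\mathbb R^3$ carries a Delaunay tetrahedral mesh (tetrahedra $D_k$, vertices $\boldsymbol x_i^D$, edges $\boldsymbol e_{ij}^D$, faces $\partial D_{km}$), with circumcenters in the interior of the tetrahedra, and the dual Voronoi mesh (cells $V_i$, nodes $\boldsymbol x_k^V$ = circumcenters of $D_k$, edges $\boldsymbol e_{km}^V$ joining $\boldsymbol x_k^V,\boldsymbol x_m^V$, faces $\partial V_{ij}$ common to $V_i,V_j$). Delaunay vertices, edges, faces, tetrahedra correspond one-to-one to Voronoi cells, faces, edges, nodes. $\mathcal G$, $\mathcal K$ are the signed edge-vertex and face-edge incidence matrices of the Delaunay mesh, $\mathcal G_V$ the signed edge-vertex incidence matrix of the Voronoi mesh (entries $0,\pm1$, consistent with fixed orientations). With $|\cdot|$ denoting length, area or volume, the following are diagonal matrices: $\mathcal D_{\boldsymbol e^D}=\mathrm{diag}(|\boldsymbol e_{ij}^D|)$, $\mathcal D_{\partial D}=\mathrm{diag}(|\partial D_{km}|)$, $\mathcal D_D=\mathrm{diag}(|D_k|)$, $\mathcal D_{\boldsymbol e^V}=\mathrm{diag}(|\boldsymbol e_{km}^V|)$, $\mathcal D_{\partial V}=\mathrm{diag}(|\partial V_{ij}|)$, $\mathcal D_V=\mathrm{diag}(|V_i|)$. MFD (mimetic finite-difference) operators as matrices: $\mathrm{grad}_D=\mathcal D_{\boldsymbol e^D}^{-1}\mathcal G$, $\mathrm{div}_D=\mathcal D_V^{-1}\mathcal G^T\mathcal D_{\partial V}$, $\mathrm{curl}_D=\mathcal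 D_{\partial D}^{-1}\mathcal K\mathcal D_{\boldsymbol e^D}$, $\mathrm{grad}_V=\mathcal D_{\boldsymbol e^V}^{-1}\mathcal G_V$, $\mathrm{div}_V=\mathcal D_D^{-1}\mathcal G_V^T\mathcal D_{\partial D}$, $\mathrm{curl}_V=\mathcal D_{\partial V}^{-1}\mathcal K^T\mathcal D_{\boldsymbol e^V}$. These satisfy (known) $\mathrm{curl}_D\mathrm{grad}_D=0$, $\mathrm{curl}_V\mathrm{grad}_V=0$, $\mathrm{div}_V\mathrm{curl}_D=0$, $\mathrm{div}_D\mathrm{curl}_V=0$. System matrix (one Crank--Nicolson step for Maxwell's equations with unit permittivity and permeability, unknowns magnetic field, electric field, auxiliary pressure): with identity matrices $\mathcal I_{\boldsymbol e^V},\mathcal I_{\boldsymbol e^D},\mathcal I_V$ (indexed by Voronoi edges, Delaunay edges, Voronoi cells), $$\mathcal A=\begin{bmatrix}\frac2\tau\mathcal I_{\boldsymbol e^V}&\mathrm{curl}_D&0\\-\mathrm{curl}_V&\frac2\tau\mathcal I_{\boldsymbol e^D}&\mathrm{grad}_D\\0&-\mathrm{div}_D&\frac2\tau\mathcal I_V\end{bmatrix}.$$ It has the exact block factorization $\mathcal A=\mathcal L\mathcal S\mathcal U$ with $$\mathcal L=\begin{bmatrix}\mathcal I_{\boldsymbol e^V}&&\\-\frac\tau2\mathrm{curl}_V&\mathcal I_{\boldsymbol e^D}&\\&-\frac\tau2\mathrm{div}_D&\mathcal I_V\end{bmatrix},\qquad\mathcal U=\begin{bmatrix}\mathcal I_{\boldsymbol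 e^V}&\frac\tau2\mathrm{curl}_D&\\&\mathcal I_{\boldsymbol e^D}&\frac\tau2\mathrm{grad}_D\\&&\mathcal I_V\end{bmatrix},$$ $\mathcal S=\mathrm{diag}\big(\frac2\tau\mathcal I_{\boldsymbol e^V},\mathcal S_{\boldsymbol E},\mathcal S_p\big)$, $\mathcal S_{\boldsymbol E}=\frac\tau2\mathrm{curl}_V\mathrm{curl}_D+\frac2\tau\mathcal I_{\boldsymbol e^D}$, $\mathcal S_p=\frac\tau2\mathrm{div}_D\mathrm{grad}_D+\frac2\tau\mathcal I_V$. $\mathcal Q_{\boldsymbol E}$ and $\mathcal Q_p$ are given preconditioners for $\mathcal S_{\boldsymbol E}$ and $\mathcal S_p$ (matrices approximating their inverses), and $\mathcal Q=\mathrm{diag}\big((\frac2\tau\mathcal I_{\boldsymbol e^V})^{-1},\mathcal Q_{\boldsymbol E},\mathcal Q_p\big)$. $\lambda(M)$ denotes the eigenvalues of $M$; a bound on $\lambda(M)$ is meant for every eigenvalue.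
   Formalization: The formal theorem adds the hypothesis min(c_{1,E},c_{1,p}) ≤ 1 ≤ max(c_{2,E},c_{2,p}); without it the claim fails, since 1 is always an eigenvalue of the preconditioned matrices (e.g. Q_E=2S_E^{-1}, Q_p=2S_p^{-1}, all constants 2). *)

(* Defs.v *)
From HB Require Import structures.
From mathcomp Require Import all_boot all_order all_algebra.
From mathcomp Require Import all_classical all_reals all_analysis.
From mathcomp Require Import complex.

Set Implicit Arguments.
Unset Strict Implicit.
Unset Printing Implicit Defensive.

Import Order.TTheory GRing.Theory Num.Theory numFieldNormedType.Exports.

Local Open Scope classical_set_scope.
Local Open Scope ring_scope.
Local Open Scope complex_scope.

Section Euclid.
Context {R : realType}.
Implicit Types (u v x y n : 'rV[R]_3) (S : set 'rV[R]_3).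

(* The library norm on 'rV[R]_3 is the maximum norm: it gives the same topology
   but not the same lengths, hence the explicit Euclidean norm. *)
Definition dotv u v : R := \sum_i u 0 i * v 0 i.
Definition enorm u : R := Num.sqrt (dotv u u).
Definition edist x y : R := enorm (x - y).

Definition triangle_area x y z : R :=
  let u := y - x in let v := z - x in
  Num.sqrt (dotv u u * dotv v v - dotv u v ^+ 2) / 2.

Definition point3 (p : R * R * R) : 'rV[R]_3 :=
  \row_(i < 3) [:: p.1.1; p.1.2; p.2]`_i.

Definition volume S : R :=
  fine (((@lebesgue_measure R \x @lebesgue_measure R) \x @lebesgue_measure R)%E
          [set p | S (point3 p)]).

(* Area of a set S contained in a plane with unit normal n, as the volume of
   the right prism of height 1 over S. *)
Definition planar_area n S : R :=
  volume [set y | exists x t, [/\ S x, 0 <= t <= 1 & y = x + t *: n]].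

End Euclid.

Record tetmesh (R : realType) := TetMesh {
  nvert : nat;
  vpos : 'I_nvert -> 'rV[R]_3;
  tets : {set {set 'I_nvert}}
}.

Section Geometry.
Context {R : realType} (K : tetmesh R).
Implicit Types (s f T : {set 'I_(nvert K)}) (i j v : 'I_(nvert K)).

Definition simplices k : {set {set 'I_(nvert K)}} :=
  [set s : {set 'I_(nvert K)} | (#|s| == k.+1) &&
     [exists T in tets K, s \subset T]]%SET.

Definition tets_of s : {set {set 'I_(nvert K)}} :=
  [set T in tets K | s \subset T]%SET.

Definition boundary_simplex s : bool :=
  [exists f in simplices 2, (#|tets_of f| == 1)%N && (s \subset f)].

Definition affine_hull s : set 'rV[R]_3 :=
  [set x | exists a : 'I_(nvert K) -> R,
     \sum_(i in s) a i = 1 /\ x = \sum_(i in s) a i *: vpos i].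

Definition convex_hull s : set 'rV[R]_3 :=
  [set x | exists a : 'I_(nvert K) -> R,
     [/\ forall i, 0 <= a i,
         \sum_(i in s) a i = 1 &
         x = \sum_(i in s) a i *: vpos i]].

(* Within the affine hull of a nondegenerate simplex the equidistant point
   exists and is unique. *)
Definition circumcenter s : 'rV[R]_3 :=
  xget 0 [set c | affine_hull s c /\
    {in s &, forall i j, edist c (vpos i) = edist c (vpos j)}].

Definition mesh_size : R :=
  \big[Num.max/0]_(T in tets K) \big[Num.max/0]_(i in T)
    \big[Num.max/0]_(j in T) edist (vpos i) (vpos j).

Definition voronoi_cell (Omega : set 'rV[R]_3) i : set 'rV[R]_3 :=
  [set x | closure Omega x /\
     forall j, edist x (vpos i) <= edist x (vpos j)].

Definition voronoi_face_area (Omega : set 'rV[R]_3) i j : R :=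
  let d := vpos j - vpos i in
  planar_area ((enorm d)^-1 *: d)
    (voronoi_cell Omega i `&` voronoi_cell Omega j).

(* Length of the Voronoi edge dual to the face f: it joins the circumcenters of
   the two tetrahedra sharing f; for a boundary face it is truncated at its
   intersection with the plane of f, which is the circumcenter of f. *)
Definition voronoi_edge_length f : R :=
  match enum (tets_of f) with
  | [:: T; T'] => edist (circumcenter T) (circumcenter T')
  | [:: T] => edist (circumcenter T) (circumcenter f)
  | _ => 0
  end.

(* The circumcenter condition makes the interior of every tetrahedron nonempty,
   so it also says that the tetrahedra are nondegenerate. The last field is the
   part of the Delaunay/Voronoi duality that makes the matrix of Voronoi face
   areas invertible: each Delaunay edge has a genuine two-dimensional dual
   face. *)
Record delaunay_mesh (Omega : set 'rV[R]_3) : Prop := DelaunayMesh {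
  domain_open : open Omega;
  domain_nonempty : Omega !=set0;
  domain_connected : connected Omega;
  domain_bounded : bounded_set Omega;
  vpos_inj : injective (@vpos R K);
  tets_card : {in tets K, forall T, #|T| = 4%N};
  tets_vertices : forall v, exists2 T, T \in tets K & v \in T;
  tets_cover : closure Omega = \bigcup_(T in [set` tets K]) convex_hull T;
  tets_conforming : {in tets K &, forall T T',
    convex_hull T `&` convex_hull T' = convex_hull (T :&: T')};
  empty_circumspheres : {in tets K, forall T, {in T, forall i j,
    edist (circumcenter T) (vpos i) <= edist (circumcenter T) (vpos j)}};
  circumcenters_interior : {in tets K, forall T,
    interior (convex_hull T) (circumcenter T)};
  voronoi_faces_nondegenerate : forall i j, [set i; j]%SET \in simplices 1 ->
    0 < voronoi_face_area Omega i j
}.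

Definition ends (e : 'I_(nvert K) * 'I_(nvert K)) : {set 'I_(nvert K)} :=
  [set e.1; e.2]%SET.

Definition corners (f : 'I_(nvert K) * 'I_(nvert K) * 'I_(nvert K)) :
  {set 'I_(nvert K)} := [set f.1.1; f.1.2; f.2]%SET.

(* Numbering and orientation of the vertices, edges and faces that carry
   unknowns. An edge (i, j) is oriented from i to j, a face (i, j, k) has the
   oriented boundary i -> j -> k -> i. [fixed] is the set of boundary simplices
   whose unknowns are eliminated by homogeneous essential boundary conditions:
   if it is empty, all simplices are numbered; if it contains all the boundary
   simplices, exactly the interior ones are. *)
Record numbering := Numbering {
  fixed : {set {set 'I_(nvert K)}};
  nv : nat;
  vertex : 'I_nv -> 'I_(nvert K);
  ne : nat;
  edge : 'I_ne -> 'I_(nvert K) * 'I_(nvert K);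
  nf : nat;
  face : 'I_nf -> 'I_(nvert K) * 'I_(nvert K) * 'I_(nvert K);
  fixed_boundary : {in fixed, forall s, boundary_simplex s};
  fixed_closed : {in fixed, forall s s' : {set 'I_(nvert K)},
    s' \subset s -> s' != finset.set0 -> s' \in fixed};
  vertex_inj : injective vertex;
  vertex_codom : forall v,
    ([set v]%SET \notin fixed) <-> exists k, vertex k = v;
  edge_inj : injective (ends \o edge);
  edge_codom : forall s,
    s \in (simplices 1 :\: fixed)%SET <-> exists e, ends (edge e) = s;
  face_inj : injective (corners \o face);
  face_codom : forall s,
    s \in (simplices 2 :\: fixed)%SET <-> exists q : 'I_nf, corners (face q) = s
}.

End Geometry.

Section Operators.
Context {R : realType} (Omega : set 'rV[R]_3) (K : tetmesh R).
Context (N : numbering K) (tau : R).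

(* edge-vertex and face-edge incidence matrices *)
Definition incG : 'M[R]_(ne N, nv N) := \matrix_(e, k)
  (((edge e).2 == vertex k)%:R - ((edge e).1 == vertex k)%:R).

Definition incK : 'M[R]_(nf N, ne N) := \matrix_(f, e)
  let: (i, j, k) := face f in
  \sum_(d <- [:: (i, j); (j, k); (k, i)])
    ((edge e == d)%:R - (edge e == (d.2, d.1))%:R).

Definition D_eD : 'M[R]_(ne N) :=
  diag_mx (\row_e edist (vpos (edge e).1) (vpos (edge e).2)).
Definition D_dD : 'M[R]_(nf N) := diag_mx (\row_f
  triangle_area (vpos (face f).1.1) (vpos (face f).1.2) (vpos (face f).2)).
Definition D_eV : 'M[R]_(nf N) :=
  diag_mx (\row_f voronoi_edge_length (corners (face f))).
Definition D_dV : 'M[R]_(ne N) :=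
  diag_mx (\row_e voronoi_face_area Omega (edge e).1 (edge e).2).
Definition D_V : 'M[R]_(nv N) :=
  diag_mx (\row_k volume (voronoi_cell Omega (vertex k))).

Definition gradD : 'M[R]_(ne N, nv N) := invmx D_eD *m incG.
Definition divD : 'M[R]_(nv N, ne N) := invmx D_V *m incG^T *m D_dV.
Definition curlD : 'M[R]_(nf N, ne N) := invmx D_dD *m incK *m D_eD.
Definition curlV : 'M[R]_(ne N, nf N) := invmx D_dV *m incK^T *m D_eV.

(* Block rows and columns: Voronoi edges (that is, Delaunay faces), Delaunay
   edges, Voronoi cells (that is, Delaunay vertices). *)
Definition matA : 'M[R]_(nf N + (ne N + nv N)) :=
  block_mx (2 / tau)%:M (row_mx curlD 0)
           (col_mx (- curlV) 0)
           (block_mx (2 / tau)%:M gradD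
                     (- divD)     (2 / tau)%:M).

Definition matL : 'M[R]_(nf N + (ne N + nv N)) :=
  block_mx 1%:M 0
           (col_mx (- (tau / 2) *: curlV) 0)
           (block_mx 1%:M                   0
                     (- (tau / 2) *: divD)  1%:M).

Definition matU : 'M[R]_(nf N + (ne N + nv N)) :=
  block_mx 1%:M (row_mx ((tau / 2) *: curlD) 0)
           0    (block_mx 1%:M ((tau / 2) *: gradD)
                          0    1%:M).

Definition matSE : 'M[R]_(ne N) :=
  (tau / 2) *: (curlV *m curlD) + (2 / tau)%:M.
Definition matSp : 'M[R]_(nv N) :=
  (tau / 2) *: (divD *m gradD) + (2 / tau)%:M.

Definition matQ (QE : 'M[R]_(ne N)) (Qp : 'M[R]_(nv N)) :
    'M[R]_(nf N + (ne N + nv N)) :=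
  block_mx (invmx (2 / tau)%:M) 0 0 (block_mx QE 0 0 Qp).

Definition X_LS QE Qp := matQ QE Qp *m invmx matL.
Definition X_SU QE Qp := invmx matU *m matQ QE Qp.
Definition X_LSU QE Qp := invmx matU *m matQ QE Qp *m invmx matL.

End Operators.


(* Every complex eigenvalue of the real matrix M is real and lies in [a, b]: in
   the partial order of R[i], x <= y requires x and y to have the same imaginary
   part. *)
Definition eigenvalues_in (R : realType) (n : nat) (M : 'M[R]_n) (a b : R) :=
  forall z : R[i],
    eigenvalue (map_mx (real_complex R) M) z -> a%:C <= z <= b%:C.

(* Main.v *)
Require Import Defs.
From HB Require Import structures.
From mathcomp Require Import all_boot all_order all_algebra.
From mathcomp Require Import all_classical all_reals all_analysis.
From mathcomp Require Import complex.

Set Implicit Arguments.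
Unset Strict Implicit.
Unset Printing Implicit Defensive.

Import Order.TTheory GRing.Theory Num.Theory numFieldNormedType.Exports.

Local Open Scope classical_set_scope.
Local Open Scope ring_scope.

(** The system matrix factors exactly as A = L S U (matA_LSU), with L and U
    block unit triangular and S block diagonal. Hence the preconditioned
    matrices are
      X_LS A = (Q S) U,   X_SU A = U^-1 (Q L S) U,   X_LSU A = U^-1 (Q S) U.
    The first is block upper triangular, the second is similar to the block
    lower triangular matrix Q L S, and the third is similar to the block
    diagonal matrix Q S; in all three cases the diagonal blocks are the identity,
    Q_E S_E and Q_p S_p. The characteristic polynomial of a block triangular
    matrix is the product of those of its diagonal blocks, so every eigenvalue
    is 1 or an eigenvalue of Q_E S_E or Q_p S_p; each of these lies in
    [c1, c2], for 1 by normalization of the preconditioners.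

    The factorization rests on curlD gradD = 0 and divD curlV = 0. Both reduce
    to the identity K G = 0 between incidence matrices (incK_incG), because the
    edge lengths and the Voronoi face areas are nonzero, so that their diagonal
    matrices cancel against the inverses. The identity K G = 0 itself says that
    the signed edges around a triangle close up. It survives the removal of the
    fixed simplices: an edge of a numbered face may be fixed, but then its ends
    are fixed too, and it contributes to no numbered vertex. *)

(** * Eigenvalues of block triangular matrices *)

Section BlockTriangularSpectrum.
Context {R : realType}.

Lemma char_poly_ublock (F : comNzRingType) m n (A : 'M[F]_m) B (D : 'M[F]_n) :
  char_poly (block_mx A B 0 D) = char_poly A * char_poly D.
Proof.
by rewrite /char_poly /char_poly_mx map_block_mx /= map_mx0 scalar_mx_block
  opp_block_mx add_block_mx oppr0 addr0 det_ublock.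
Qed.

Lemma char_poly_lblock (F : comNzRingType) m n (A : 'M[F]_m) C (D : 'M[F]_n) :
  char_poly (block_mx A 0 C D) = char_poly A * char_poly D.
Proof.
by rewrite /char_poly /char_poly_mx map_block_mx /= map_mx0 scalar_mx_block
  opp_block_mx add_block_mx oppr0 addr0 det_lblock.
Qed.

Lemma eigenvalues_in_ublock m n (A : 'M[R]_m) B (D : 'M[R]_n) a b :
  eigenvalues_in A a b -> eigenvalues_in D a b ->
  eigenvalues_in (block_mx A B 0 D) a b.
Proof.
move=> hA hD z.
rewrite map_block_mx map_mx0 eigenvalue_root_char char_poly_ublock rootM.
by rewrite -!eigenvalue_root_char => /orP[/hA|/hD].
Qed.

Lemma eigenvalues_in_lblock m n (A : 'M[R]_m) C (D : 'M[R]_n) a b :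
  eigenvalues_in A a b -> eigenvalues_in D a b ->
  eigenvalues_in (block_mx A 0 C D) a b.
Proof.
move=> hA hD z.
rewrite map_block_mx map_mx0 eigenvalue_root_char char_poly_lblock rootM.
by rewrite -!eigenvalue_root_char => /orP[/hA|/hD].
Qed.

Lemma eigenvalues_in_conj n (P M : 'M[R]_n) a b : P \in unitmx ->
  eigenvalues_in M a b -> eigenvalues_in (invmx P *m (M *m P)) a b.
Proof.
move=> uP hM z /eigenvalueP[v ev v_neq0]; apply: hM; apply/eigenvalueP.
have uP' : map_mx (real_complex R) P \in unitmx by rewrite map_unitmx.
exists (v *m invmx (map_mx (real_complex R) P)).
  by rewrite scalemxAl -ev !map_mxM map_invmx !mulmxA mulmxK.
by apply: contraNneq v_neq0 => v0; rewrite -(mulmxKV uP' v) v0 mul0mx.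
Qed.

Lemma eigenvalues_in_widen n (M : 'M[R]_n) a b a' b' :
  a' <= a -> b <= b' -> eigenvalues_in M a b -> eigenvalues_in M a' b'.
Proof.
move=> a'a bb' hM z /hM /andP[az zb]; apply/andP; split.
  by apply: le_trans az; rewrite lecR.
by apply: le_trans zb _; rewrite lecR.
Qed.

Lemma eigenvalues_in1 n (a b : R) : a <= 1 <= b ->
  eigenvalues_in (1%:M : 'M[R]_n) a b.
Proof.
move=> /andP[a1 b1] z /eigenvalueP[v].
rewrite map_mx1 mulmx1 -[X in X = _]scale1r => /eqP.
rewrite -subr_eq0 -scalerBl scaler_eq0 subr_eq0 => /orP[/eqP<- _|/eqP-> /eqP//].
by rewrite -(rmorph1 (real_complex R)) !lecR a1.
Qed.

End BlockTriangularSpectrum.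

(** * Incidence relations *)

Section Incidence.
Context {R : realType} (K : tetmesh R) (N : numbering K).

Lemma sub_simplices k m (s s' : {set 'I_(nvert K)}) :
  s \in simplices K k -> s' \subset s -> #|s'| = m.+1 -> s' \in simplices K m.
Proof.
rewrite !inE => /andP[_ /existsP[T /andP[TK sT]]] s's ->; rewrite eqxx /=.
by apply/existsP; exists T; rewrite TK (fintype.subset_trans s's sT).
Qed.

Lemma ends_edge_simplices (e : 'I_(ne N)) :
  ends (edge e) \in simplices K 1.
Proof.
have /edge_codom : exists e' : 'I_(ne N), ends (edge e') = ends (edge e).
  by exists e.
by case/setDP.
Qed.

Lemma edge_neq (e : 'I_(ne N)) : (edge e).1 != (edge e).2.
Proof.
have := ends_edge_simplices e; rewrite inE => /andP[+ _].
by rewrite cards2; case: (_ != _).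
Qed.

Lemma face_uniq (f : 'I_(nf N)) :
  [/\ (face f).1.1 != (face f).1.2, (face f).1.2 != (face f).2
    & (face f).2 != (face f).1.1].
Proof.
have /face_codom : exists f' : 'I_(nf N), corners (face f') = corners (face f).
  by exists f.
case/setDP; rewrite inE => /andP[+ _] _.
case: (face f) => [[i j] k]; rewrite /corners /= finset.setUC cardsU1 cards2 !inE.
rewrite negb_or (eq_sym j k).
by case: (k == i); case: (k == j); case: (i == j).
Qed.

Lemma face_edge_simplices (f : 'I_(nf N)) i j :
  i \in corners (face f) -> j \in corners (face f) -> i != j ->
  [set i; j]%SET \in simplices K 1.
Proof.
move=> fi fj ij.
have /face_codom : exists f' : 'I_(nf N), corners (face f') = corners (face f).
  by exists f.
case/setDP => fS _; apply: (sub_simplices fS); last by rewrite cards2 ij.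
by apply/fintype.subsetP => x /set2P[]->.
Qed.

(** The increment of a vertex indicator along an oriented mesh edge (i, j),
    computed from the row of the incidence matrix of the numbered edges. It
    holds for edges without a number too: such an edge is fixed, hence so are
    its ends, so that both sides vanish at a numbered vertex. *)
Lemma sum_edge_incG i j (k : 'I_(nv N)) :
  i != j -> [set i; j]%SET \in simplices K 1 ->
  \sum_e ((edge e == (i, j))%:R - (edge e == (j, i))%:R) * incG N e k
    = (j == vertex k)%:R - (i == vertex k)%:R :> R.
Proof.
move=> ij sij.
(* Either [set i; j] is fixed, and then no end of it is numbered, or it is the
   set of ends of exactly one numbered edge, in one of the two orientations. *)
have [fx|nfx] := boolP ([set i; j]%SET \in fixed N).
  have nvtx v : v \in [set i; j]%SET -> (v == vertex k) = false.
    move=> vij; apply/negP => /eqP vk.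
    have /vertex_codom/negP[] : exists k' : 'I_(nv N), vertex k' = v by exists k.
    apply: (fixed_closed fx); first by rewrite finset.sub1set.
    by apply/finset.set0Pn; exists v; rewrite inE.
  rewrite !nvtx ?set21 ?set22 // subrr big1 // => e _; rewrite mxE.
  case: (eqVneq (edge e) (i, j)) => [->|_] /=.
    by rewrite !nvtx ?set21 ?set22 // subrr mulr0.
  case: (eqVneq (edge e) (j, i)) => [->|_] /=; last by rewrite subrr mul0r.
  by rewrite !nvtx ?set21 ?set22 // subrr mulr0.
have /edge_codom[e ee] : [set i; j]%SET \in (simplices K 1 :\: fixed N)%SET.
  by rewrite inE nfx sij.
have e_only e' : e' != e -> (edge e' == (i, j)) || (edge e' == (j, i)) = false.
  move=> ne; apply: contraNF ne => h; apply/eqP/(@edge_inj _ _ N).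
  by rewrite /= ee; case/orP: h => /eqP->; rewrite /ends //= finset.setUC.
rewrite (bigD1 e) //= big1 ?addr0 => [|e' /e_only/norP/=]; last first.
  by case=> /negPf-> /negPf->; rewrite subrr mul0r.
have : edge e = (i, j) \/ edge e = (j, i).
  have := edge_neq e; move: ee; rewrite /ends; case: (edge e) => x y /= /setP ee.
  have := ee x; have := ee y; rewrite !inE !eqxx orbT /=.
  by move=> /esym/orP[]/eqP-> /esym/orP[]/eqP->; rewrite ?eqxx //; [right|left].
case=> he; rewrite mxE he /= eqxx xpair_eqE.
  by rewrite (negPf ij) /= subr0 mul1r.
by rewrite eq_sym (negPf ij) /= sub0r mulN1r opprB.
Qed.

(** The boundary of a boundary vanishes, also after the elimination of the
    fixed unknowns. *)
Lemma incK_incG : incK N *m incG N = 0.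
Proof.
apply/matrixP => f k; rewrite !mxE.
under eq_bigr do rewrite mxE.
have [] := face_uniq f; have := @face_edge_simplices f.
case: (face f) => [[x y] z]; rewrite /corners /= => sf xy yz zx.
under eq_bigr do rewrite mulr_suml.
rewrite exchange_big /= !big_cons big_nil /=.
rewrite !sum_edge_incG // ?sf // ?inE ?eqxx ?orbT //.
by rewrite addr0 addrCA !subrKA subrr.
Qed.

End Incidence.

(** * Exactness relations and factorization of the system matrix *)

Section Factorization.
Context {R : realType} (Omega : set 'rV[R]_3) (K : tetmesh R).
Context (hK : delaunay_mesh K Omega) (N : numbering K).

Lemma diag_mx_unit (F : fieldType) n (d : 'rV[F]_n) :
  (forall i, d 0 i != 0) -> diag_mx d \in unitmx.
Proof.
by move=> d0; rewrite unitmxE det_diag unitfE; apply/prodf_neq0 => i _.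
Qed.

(** The qualified name is the Euclidean distance, as opposed to the extended
    distance of a pseudometric space. *)
Lemma edist_neq0 (x y : 'rV[R]_3) : x != y -> Defs.edist x y != 0.
Proof.
apply: contraNneq => /eqP; rewrite /Defs.edist /enorm sqrtr_eq0 => le0.
have sq i : true -> 0 <= (x - y) 0 i * (x - y) 0 i by rewrite -expr2 sqr_ge0.
have s0 : \sum_i (x - y) 0 i * (x - y) 0 i = 0.
  by apply: le_anti; rewrite le0 sumr_ge0.
apply/eqP/rowP => i; have /eqP : (x - y) 0 i * (x - y) 0 i = 0.
  exact: (psumr_eq0P sq s0).
by rewrite mulf_eq0 orbb !mxE subr_eq0 => /eqP.
Qed.

Lemma D_eD_unit : D_eD N \in unitmx.
Proof.
apply: diag_mx_unit => e; rewrite mxE; apply: edist_neq0.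
by rewrite (inj_eq (vpos_inj hK)) edge_neq.
Qed.

Lemma D_dV_unit : D_dV Omega N \in unitmx.
Proof.
apply: diag_mx_unit => e; rewrite mxE gt_eqF //.
exact/(voronoi_faces_nondegenerate hK)/ends_edge_simplices.
Qed.

Lemma curlD_gradD : curlD N *m gradD N = 0.
Proof.
by rewrite /curlD /gradD mulmxA mulmxK ?D_eD_unit // -mulmxA incK_incG mulmx0.
Qed.

Lemma divD_curlV : divD Omega N *m curlV Omega N = 0.
Proof.
rewrite /curlV /divD !mulmxA mulmxK ?D_dV_unit // -(mulmxA (invmx _)).
by rewrite -trmx_mul incK_incG trmx0 mulmx0 mul0mx.
Qed.

Context (tau : R) (htau : 0 < tau).

Lemma scalar_2tau_unit n : (2 / tau)%:M \in @unitmx R n.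
Proof. by rewrite unitmxE det_scalar unitrX // unitfE gt_eqF // divr_gt0. Qed.

(** The block diagonal factor of the system matrix: a multiple of the
    identity on the Voronoi edges, then the Schur complements on the Delaunay edges and
    on the Voronoi cells. *)
Definition matS : 'M[R]_(nf N + (ne N + nv N)) :=
  block_mx (2 / tau)%:M 0
           0 (block_mx (matSE Omega N tau) 0 0 (matSp Omega N tau)).

(** By curlD gradD = 0 and divD curlV = 0, the products that have no counterpart
    in the system matrix vanish: S_E acts on gradients, and under the divergence, as
    the scalar 2 / tau. *)
Lemma matA_LSU : matA Omega N tau = matL Omega N tau *m matS *m matU N tau.
Proof.
have t0 : tau != 0 by rewrite gt_eqF.
have tt : tau / 2 * (2 / tau) = 1.
  by rewrite mulrA divfK ?pnatr_eq0 // divff.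
(* S_E *m gradD = (2 / tau) *: gradD, since curlD *m gradD = 0. *)
have SEgrad : (tau / 2) *: (matSE Omega N tau *m gradD N) = gradD N.
  rewrite mulmxDl -scalemxAl -mulmxA curlD_gradD mulmx0 scaler0 add0r.
  by rewrite mul_scalar_mx scalerA tt scale1r.
(* divD *m S_E = (2 / tau) *: divD, since divD *m curlV = 0. *)
have divSE : (tau / 2) *: (divD Omega N *m matSE Omega N tau) = divD Omega N.
  rewrite mulmxDr -scalemxAr mulmxA divD_curlV mul0mx scaler0 add0r.
  by rewrite mul_mx_scalar scalerA tt scale1r.
have scK m n (X : 'M[R]_(m, n)) : (2 / tau)%:M *m ((tau / 2) *: X) = X.
  by rewrite -scalemxAr mul_scalar_mx scalerA tt scale1r.
have scNK m n (X : 'M[R]_(m, n)) : - (tau / 2) *: X *m (2 / tau)%:M = - X.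
  by rewrite -scalemxAl mul_mx_scalar scalerA mulNr tt scaleN1r.
rewrite /matA /matL /matS /matU !mulmx_block.
rewrite ?mul0mx ?mulmx0 ?mul1mx ?mulmx1 ?addr0 ?add0r.
rewrite !mul_col_mx ?mul_mx_row !mul_row_block ?mul0mx ?mulmx0 ?mulmx1.
rewrite addr0 scK scNK add_col_mx !add_row_mx !addr0 !add0r -block_mxEv.
rewrite -(scalemxAl _ (divD _ _)) scaleNr divSE -!scalemxAr SEgrad !mulNmx.
by rewrite /matSE /matSp !scalerN !addKr.
Qed.

Lemma matU_unit : matU N tau \in unitmx.
Proof. by rewrite unitmxE !det_ublock !det1 !mulr1 unitr1. Qed.

Lemma matL_unit : matL Omega N tau \in unitmx.
Proof. by rewrite unitmxE !det_lblock !det1 !mulr1 unitr1. Qed.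

Context (QE : 'M[R]_(ne N)) (Qp : 'M[R]_(nv N)).

Lemma matQ_matS : matQ tau QE Qp *m matS =
  block_mx 1%:M 0
           0 (block_mx (QE *m matSE Omega N tau) 0 0 (Qp *m matSp Omega N tau)).
Proof.
rewrite !mulmx_block !mulmx0 !mul0mx !addr0 !add0r.
by rewrite mulVmx ?scalar_2tau_unit.
Qed.

(** Here and in the next two lemmas, the preconditioned matrix is, possibly up
    to conjugation by U, a block triangular matrix with the diagonal blocks of
    Q *m S. *)
Lemma X_LS_matA : X_LS Omega tau QE Qp *m matA Omega N tau =
  (matQ tau QE Qp *m matS) *m matU N tau.
Proof. by rewrite matA_LSU /X_LS -!mulmxA mulKmx // matL_unit. Qed.

Lemma X_SU_matA : X_SU tau QE Qp *m matA Omega N tau =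
  invmx (matU N tau) *m
    (matQ tau QE Qp *m (matL Omega N tau *m matS) *m matU N tau).
Proof. by rewrite matA_LSU /X_SU !mulmxA. Qed.

Lemma X_LSU_matA : X_LSU Omega tau QE Qp *m matA Omega N tau =
  invmx (matU N tau) *m ((matQ tau QE Qp *m matS) *m matU N tau).
Proof. by rewrite matA_LSU /X_LSU -!mulmxA mulKmx // matL_unit. Qed.

End Factorization.

(* The first diagonal block of Q S is the identity matrix, so that 1 is always
   an eigenvalue of the preconditioned matrices: [hone] is the normalization of
   the preconditioners under which the conclusion can hold. *)
Theorem theorem5p1 (R : realType) (Omega : set 'rV[R]_3)
    (c1E c2E c1p c2p : R)
    (hone : Num.min c1E c1p <= 1 <= Num.max c2E c2p)
    (K : tetmesh R) (hK : delaunay_mesh K Omega) (N : numbering K)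
    (h : R) (hh : mesh_size K = h) (tau : R) (htau : 0 < tau)
    (QE : 'M[R]_(ne N)) (Qp : 'M[R]_(nv N))
    (hE : eigenvalues_in (QE *m matSE Omega N tau) c1E c2E)
    (hp : eigenvalues_in (Qp *m matSp Omega N tau) c1p c2p) :
  let c1 := Num.min c1E c1p in
  let c2 := Num.max c2E c2p in
  [/\ eigenvalues_in (X_LS Omega tau QE Qp *m matA Omega N tau) c1 c2,
      eigenvalues_in (X_SU tau QE Qp *m matA Omega N tau) c1 c2
    & eigenvalues_in (X_LSU Omega tau QE Qp *m matA Omega N tau) c1 c2].
Proof.
move=> c1 c2.
have h1 n : eigenvalues_in (1%:M : 'M[R]_n) c1 c2 by exact: eigenvalues_in1.
have {}hE : eigenvalues_in (QE *m matSE Omega N tau) c1 c2.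
  by apply: eigenvalues_in_widen hE; rewrite ?ge_min ?le_max lexx.
have {}hp : eigenvalues_in (Qp *m matSp Omega N tau) c1 c2.
  by apply: eigenvalues_in_widen hp; rewrite ?ge_min ?le_max lexx orbT.
split.
- rewrite (X_LS_matA hK) // matQ_matS // !mulmx_block.
  rewrite !mul0mx !mulmx0 !mulmx1 ?mul1mx ?addr0 ?add0r.
  apply: eigenvalues_in_ublock; first exact: h1.
  by apply: eigenvalues_in_ublock.
- rewrite (X_SU_matA hK) //; apply: eigenvalues_in_conj; first exact: matU_unit.
  rewrite /matL /matS /matQ !mulmx_block.
  rewrite !mul0mx !mulmx0 !mul1mx ?addr0 ?add0r.
  rewrite mulmx0 mulVmx ?scalar_2tau_unit //.
  apply: eigenvalues_in_lblock; first exact: h1.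
  rewrite mulmx_block !mul0mx !mulmx0 !addr0 !add0r.
  exact: eigenvalues_in_lblock.
- rewrite (X_LSU_matA hK) //; apply: eigenvalues_in_conj; first exact: matU_unit.
  rewrite matQ_matS //; apply: eigenvalues_in_ublock; first exact: h1.
  exact: eigenvalues_in_ublock.
Qed.
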